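(* Let $M$ be an oriented one-cusped hyperbolic 3-manifold with an ideal triangulation $\mathcal T$ with $N$ tetrahedra, let $\alpha:\pi_1(M)\to\mathbb Z$ be an epimorphism and $\mu$ a peripheral curve with $\alpha(\mu)=1$. Let $\mathbf G^\square(t)$ ($\square$ ranging over the three quad types, i.e. $\mathbf G(t),\mathbf G'(t),\mathbf G''(t)$), $\mathbf A(t)$, $\mathbf B(t)$ be the twisted gluing equation matrices and twisted Neumann--Zagier matrices of $\mathcal T$, and for $n\ge 1$ let $\mathbf G^{(n)\square}$, $\mathbf A^{(n)}$, $\mathbf B^{(n)}$ be the (untwisted) gluing equation matrices and Neumann--Zagier matrices of the induced ideal triangulation $\mathcal T^{(n)}$ of the $n$-fold cyclic cover $M^{(n)}$. Writing $\mathbf X(t)=\sum_{r\in\mathbb Z}\mathbf X_r t^r$, one has the $nN\times nN$ block circulant form $$ \mathbf X^{(n)}=\begin{pmatrix} \sum_{r\equiv 0}\mathbf X_r & \sum_{r\equiv 1}\mathbf X_r & \cdots & \sum_{r\equiv n-1}\mathbf X_r\\ \sum_{r\equiv n-1}\mathbf X_r & \sum_{r\equiv 0}\mathbf X_r & \cdots & \sum_{r\equiv n-2}\mathbf X_r\\ \vdots&\vdots&\ddots&\vdots\\ \sum_{r\equiv 1}\mathbf X_r & \sum_{r\equiv 2}\mathbf X_r & \cdots & \sum_{r\equiv 0}\mathbf X_r \end{pmatrix} $$ for $\mathbf X=\mathbf G^\square$, $\mathbf A$ or $\mathbf B$, where $\equiv$ denotes congruence modulo $n$ and each sum is over $r\in\mathbb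 Z$.
   Context: $M$ is an oriented (complete, finite volume) hyperbolic 3-manifold with one torus cusp. An ideal triangulation $\mathcal T$ of $M$ with $N$ tetrahedra $\Delta_1,\dots,\Delta_N$ has exactly $N$ edges $e_1,\dots,e_N$. A quad type of a tetrahedron is a pair of opposite edges. Fixing a quad type of each oriented tetrahedron $\Delta_j$, the pairs of opposite edges of $\Delta_j$ are labelled by $z_j,z_j',z_j''$ (the chosen quad type gets $z_j$; seen from each ideal vertex the labels occur in the counterclockwise cyclic order $z_j,z'_j,z''_j$). The symbol $\square$ stands for no prime, one prime or two primes. The gluing equation matrix $\mathbf G^\square$ is the $N\times N$ integer matrix whose $(i,j)$-entry is the number of edges of $\Delta_j$ labelled $z_j^\square$ that are incident (identified) to $e_i$ in $\mathcal T$; the Neumann--Zagier matrices are $\mathbf A=\mathbf G-\mathbf G'$, $\mathbf B=\mathbf G''-\mathbf G'$. A peripheral curve is an oriented homotopically non-trivial simple closed curve in the peripheral torus of $M$. $\widetilde M$ and $M^{(n)}$ are the covers of $M$ corresponding to $\alpha^{-1}(0)$ and $\alpha^{-1}(n\mathbb Z)$; $\mathcal T$ lifts to ideal triangulations $\widetilde{\mathcal T}$ of $\widetilde M$ and $\mathcal T^{(n)}$ of $M^{(n)}$ (with lifted quad types). The deck group $\mathbb Z$ of $\widetilde M\to M$ is generated by the action of $\mu$. Choose lifts $\widetilde e_i,\widetilde\Delta_j$ of $e_i,\Delta_j$ to $\widetilde{\mathcal T}$. For $k\in\mathbb Z$, $\mathbf G_k^\square$ is the $N\times N$ matrix whose $(i,j)$-entry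 is the number of edges of $\mu^k\cdot\widetilde\Delta_j$ labelled $z_j^\square$ that are incident to $\widetilde e_i$ in $\widetilde{\mathcal T}$ (zero for all but finitely many $k$). The twisted matrices are $\mathbf G^\square(t)=\sum_{k}\mathbf G_k^\square t^k$, $\mathbf A(t)=\mathbf G(t)-\mathbf G'(t)$, $\mathbf B(t)=\mathbf G''(t)-\mathbf G'(t)$. The $nN$ edges and $nN$ tetrahedra of $\mathcal T^{(n)}$ are ordered in $n$ blocks of size $N$: the $k$-th block ($k=0,\dots,n-1$) consists of the images in $\mathcal T^{(n)}$ of $\mu^k\cdot\widetilde e_1,\dots,\mu^k\cdot\widetilde e_N$, respectively of $\mu^k\cdot\widetilde\Delta_1,\dots,\mu^k\cdot\widetilde\Delta_N$. *)

(* Defs.v *)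
From HB Require Import structures.
From Stdlib Require Import Relation_Operators.
From mathcomp Require Import all_boot all_order all_algebra all_fingroup.
From mathcomp Require Import all_classical all_reals all_analysis.

Set Implicit Arguments.
Unset Strict Implicit.
Unset Printing Implicit Defensive.

Import Order.TTheory GRing.Theory Num.Theory.
Import numFieldNormedType.Exports.
Local Notation qrepr := generic_quotient.repr.
Local Open Scope classical_set_scope.
Local Open Scope ring_scope.

Definition two4 : 'I_4 := @Ordinal 4 2 isT.
Definition three4 : 'I_4 := @Ordinal 4 3 isT.

(* Oriented triangulation whose tetrahedra are indexed by D (finite for T and
   T^(n), infinite for the triangulation of the infinite cyclic cover).  The
   vertices of each tetrahedron are numbered by 'I_4, and face f is the face
   opposite to vertex f.  Face f of d is glued to face (gperm d f f) of
   (nbr d f), a vertex v <> f being sent to gperm d f v.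
   The orientation is carried by the vertex numbering: seen from vertex 0, the
   edges 01, 02, 03 occur in counterclockwise order; the gluings reverse the
   induced orientations of the faces, so all gperm are odd. *)
Record triangulation (D : Type) := Triangulation {
  nbr : D -> 'I_4 -> D;
  gperm : D -> 'I_4 -> 'S_4;
  nbrK : forall d f, nbr (nbr d f) (gperm d f f) = d;
  gpermK : forall d f, gperm (nbr d f) (gperm d f f) = ((gperm d f)^-1)%g;
  glue_free : forall d f, (nbr d f, gperm d f f) <> (d, f);
  gperm_odd : forall d f, odd_perm (gperm d f)
}.

(* An edge of a tetrahedron d is (d, a) with a a 2-element set of vertices; an
   edge of the triangulation is a class of these under edge_eq. *)
Section Edges.
Variables (D : Type) (T : triangulation D).

Definition edge_step (x y : D * {set 'I_4}) : Prop :=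
  exists2 f, f \notin x.2 & y = (nbr T x.1 f, gperm T x.1 f @: x.2).

Definition edge_eq := clos_refl_sym_trans _ edge_step.

Definition vertex_step (x y : D * 'I_4) : Prop :=
  exists2 f, f != x.2 & y = (nbr T x.1 f, gperm T x.1 f x.2).

(* The ideal vertex classes are the cusps of M; the link of such a class is the
   peripheral surface, a torus when M is orientable and hyperbolic. *)
Definition one_cusped := forall x y, clos_refl_sym_trans _ vertex_step x y.

(* The pairs of opposite edges 01|23, 02|13, 03|12. *)
Definition quad_pair (k : 'I_3) : {set {set 'I_4}} :=
  [set [set ord0; lift ord0 k]; ~: [set ord0; lift ord0 k]]%SET.

(* If q d is the chosen quad type of d, the pair labelled z, z', z'' is
   quad_pair (q d + p) for p = 0, 1, 2; addition in 'I_3 is modulo 3.  By the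
   orientation convention above, from each vertex the labels z, z', z'' then
   occur in counterclockwise order. *)
Definition incidence (q : D -> 'I_3) (p : 'I_3) (x : D * {set 'I_4}) (d : D)
    : int :=
  #|[set a in quad_pair (q d + p) | `[< edge_eq (d, a) x >]]%SET|%:Z.

Definition gluing_mx (q : D -> 'I_3) m (e : 'I_m -> D * {set 'I_4})
    (t : 'I_m -> D) (p : 'I_3) : 'M[int]_m :=
  \matrix_(i, j) incidence q p (e i) (t j).

Definition edge_enumeration m (e : 'I_m -> D * {set 'I_4}) : Prop :=
  (forall i, #|(e i).2| = 2%N) /\
  (forall d (a : {set 'I_4}), #|a| = 2%N -> exists! i, edge_eq (d, a) (e i)).

End Edges.

(* G 0, G 1, G 2 are the matrices for z, z', z''. *)
Definition NZA (V : zmodType) (G : 'I_3 -> V) : V := G 0 - G 1.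
Definition NZB (V : zmodType) (G : 'I_3 -> V) : V := G 2%:R - G 1.

(* Edge paths in a 2-complex with vertex set S, where stop s p is the endpoint
   of the path p from s and rel s is a set of null-homotopic loops at s. *)
Section Homotopy.
Variables (S F : Type) (stop : S -> seq F -> S) (rel : S -> seq F -> Prop).

Definition htpy_step (s : S) (u v : seq F) : Prop :=
  exists p r r', [/\ u = p ++ r ++ r', v = p ++ r' & rel (stop s p) r].

Definition htpy (s : S) := clos_refl_sym_trans _ (htpy_step s).

End Homotopy.

(* pi_1 of M is computed in the dual 2-complex: its vertices are the tetrahedra,
   its edges the faces, and its 2-cells the edges of T.  A path is the sequence
   of the faces it crosses. *)
Section FundamentalGroup.
Variables (D : Type) (T : triangulation D).

Fixpoint stop (d : D) (p : seq 'I_4) : D :=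
  if p is f :: p' then stop (nbr T d f) p' else d.

Fixpoint pinv (d : D) (p : seq 'I_4) : seq 'I_4 :=
  if p is f :: p' then rcons (pinv (nbr T d f) p') (gperm T d f f) else [::].

(* (d, r) stands for the edge r0 r1 of d, about to be turned around by leaving
   d through the face opposite to r3, the face opposite to r2 being the other
   one at that edge. *)
Definition turn (x : D * 'S_4) : D * 'S_4 :=
  let f := x.2 three4 in
  (nbr T x.1 f, (tperm two4 three4 * x.2 * gperm T x.1 f)%g).

Definition turn_path (x : D * 'S_4) (m : nat) : seq 'I_4 :=
  [seq (iter k turn x).2 three4 | k <- iota 0 m].

Definition relator (d : D) (r : seq 'I_4) : Prop :=
  (exists f, r = [:: f; gperm T d f f]) \/
  (exists (rho : 'S_4) m,
     iter m turn (d, rho) = (d, rho) /\ r = turn_path (d, rho) m).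

Definition path_htpy : D -> seq 'I_4 -> seq 'I_4 -> Prop := htpy stop relator.

(* The link of a vertex is triangulated by one triangle (d, v) for each corner
   v of a tetrahedron d in the class; its sides lie in the faces f <> v of d
   and its vertices on the edges of d at v. *)
Fixpoint lstop (x : D * 'I_4) (p : seq 'I_4) : D * 'I_4 :=
  if p is f :: p' then lstop (nbr T x.1 f, gperm T x.1 f x.2) p' else x.

Fixpoint lpath (x : D * 'I_4) (p : seq 'I_4) : bool :=
  if p is f :: p' then
    (f != x.2) && lpath (nbr T x.1 f, gperm T x.1 f x.2) p'
  else true.

Definition lrelator (x : D * 'I_4) (r : seq 'I_4) : Prop :=
  (exists2 f, f != x.2 & r = [:: f; gperm T x.1 f f]) \/
  (exists (rho : 'S_4) m,
     [/\ rho ord0 = x.2, iter m turn (x.1, rho) = (x.1, rho)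
     & r = turn_path (x.1, rho) m]).

Definition link_htpy : D * 'I_4 -> seq 'I_4 -> seq 'I_4 -> Prop :=
  htpy lstop lrelator.

End FundamentalGroup.

(* A simple closed curve in the link, as a normal curve: the closed sequence p
   of sides that it crosses, with a crossing point y k, in barycentric
   coordinates, in the interior of the k-th side.  In each triangle it visits
   it is a straight segment joining two different sides, and these segments are
   pairwise disjoint. *)
Section PeripheralCurves.
Variables (R : realType) (D : Type) (T : triangulation D).

Definition in_segment (x y z : 'rV[R]_4) : Prop :=
  exists2 s : R, 0 <= s <= 1 & z = (1 - s) *: x + s *: y.

Definition simple_closed_curve (x : D * 'I_4) (p : seq 'I_4) : Prop :=
  [/\ p != [::], lpath T x p, lstop T x p = x &
  exists y : nat -> 'rV[R]_4,
    let tri k := lstop T x (take k p) in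
    let side k := nth ord0 p k in
    let prev k := if k is k'.+1 then k' else (size p).-1 in
    let glue k := gperm T (tri k).1 (side k) in
    let entry k := col_perm ((glue (prev k))^-1)%g (y (prev k)) in
    [/\ forall k, (k < size p)%N ->
          [/\ \sum_w y k ord0 w = 1,
              forall w, w \in [:: (tri k).2; side k] -> y k ord0 w = 0
            & forall w, w \notin [:: (tri k).2; side k] -> 0 < y k ord0 w],
        forall k, (k < size p)%N -> side k != glue (prev k) (side (prev k))
      & forall k l, (k < size p)%N -> (l < size p)%N -> k != l ->
          tri k = tri l ->
          ~ exists z, in_segment (entry k) (y k) z /\
                      in_segment (entry l) (y l) z]].

(* The loop mu at the base tetrahedron b is, up to homotopy, a peripheral curve
   joined to b by a path c. *)
Definition peripheral (b : D) (mu : seq 'I_4) : Prop :=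
  exists (c p : seq 'I_4) (v : 'I_4),
    let x := (stop T b c, v) in
    [/\ simple_closed_curve x p, ~ link_htpy T x p [::]
      & path_htpy T b mu (c ++ p ++ pinv T b c)].

End PeripheralCurves.

(* Hyperbolic 3-space is the upper half-space; hdist p q = cosh d(p, q) - 1. *)
Section Hyperbolic.
Variable R : realType.

Local Notation U := (R * R * R)%type.

Definition half_space : set U := [set p | 0 < p.2].

Definition hdist (p q : U) : R :=
  ((p.1.1 - q.1.1) ^+ 2 + (p.1.2 - q.1.2) ^+ 2 + (p.2 - q.2) ^+ 2)
  / (2 * p.2 * q.2).

(* A group of isometries of half_space (inverses being taken on half_space)
   that acts freely and properly discontinuously. *)
Definition deck_group (Gam : set (U -> U)) : Prop :=
  [/\ Gam id,
      forall g h, Gam g -> Gam h -> Gam (g \o h),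
      forall g, Gam g ->
        exists2 h, Gam h & forall p, half_space p -> h (g p) = p,
      forall g, Gam g ->
        (forall p, half_space p -> half_space (g p)) /\
        (forall p q, half_space p -> half_space q ->
           hdist (g p) (g q) = hdist p q)
    & forall p, half_space p -> exists V : set U,
        [/\ open V, V p & forall g x, Gam g -> half_space x ->
           V x -> V (g x) -> forall y, half_space y -> g y = y]].

Definition lebesgue3 :=
  ((@lebesgue_measure R \x @lebesgue_measure R) \x @lebesgue_measure R)%E.

Definition finite_covolume (Gam : set (U -> U)) : Prop :=
  exists F : set U,
    [/\ measurable F, F `<=` half_space,
        forall p, half_space p -> exists2 g, Gam g & F (g p)
      & (\int[lebesgue3]_(p in F) ((p.2 ^+ 3)^-1)%:E < +oo)%E].

(* The realization of T without its vertices: points (d, x) with x in the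
   standard simplex minus its vertices, modulo the face gluings. *)
Section Realization.
Variables (D : Type) (T : triangulation D).

Definition ideal_simplex : set 'rV[R]_4 :=
  [set x | [/\ forall i, 0 <= x ord0 i, \sum_i x ord0 i = 1
             & forall i, x ord0 i != 1]].

Definition glue_step (x y : D * 'rV[R]_4) : Prop :=
  [/\ ideal_simplex x.2 & exists2 f, x.2 ord0 f = 0
    & y = (nbr T x.1 f, col_perm ((gperm T x.1 f)^-1)%g x.2)].

Definition glue_eq := clos_refl_sym_trans _ glue_step.

Definition saturated (S : set (D * 'rV[R]_4)) : Prop :=
  forall x y, glue_eq x y -> S x -> S y.

Definition open_realization (S : set (D * 'rV[R]_4)) : Prop :=
  forall d, exists2 O : set 'rV[R]_4, open O &
    forall x, ideal_simplex x -> (O x <-> S (d, x)).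

(* dev induces a homeomorphism from the quotient of half_space by Gam to the
   realization without vertices; both carry the quotient topology. *)
Definition induces_homeo (Gam : set (U -> U)) (dev : U -> D * 'rV[R]_4) :
    Prop :=
  [/\ forall p, half_space p -> ideal_simplex (dev p).2,
      forall x, ideal_simplex x.2 ->
        exists2 p, half_space p & glue_eq (dev p) x,
      forall p q, half_space p -> half_space q ->
        (glue_eq (dev p) (dev q) <-> exists2 g, Gam g & q = g p)
    & forall S, saturated S ->
        (open_realization S <-> open (half_space `&` dev @^-1` S))].

Definition hyperbolic : Prop := exists Gam dev,
  [/\ deck_group Gam, finite_covolume Gam & induces_homeo Gam dev].

End Realization.
End Hyperbolic.

(* An epimorphism from pi_1(M, b) to Z, as a homotopy invariant function on
   loops; its values on other paths are irrelevant. *)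
Record epi_to_Z (D : Type) (T : triangulation D) (b : D) := EpiToZ {
  epi_fun :> seq 'I_4 -> int;
  epi_htpy : forall p q, stop T b p = b -> path_htpy T b p q ->
    epi_fun p = epi_fun q;
  epi_cat : forall p q, stop T b p = b -> stop T b q = b ->
    epi_fun (p ++ q) = epi_fun p + epi_fun q;
  epi_surj : forall z, exists2 p, stop T b p = b & epi_fun p = z
}.

Section PathLemmas.
Variables (D : Type) (T : triangulation D).

Lemma stop_cat d p q : stop T d (p ++ q) = stop T (stop T d p) q.
Proof. by elim: p d => //= f p IH d. Qed.

Lemma stop_pinv d p : stop T (stop T d p) (pinv T d p) = d.
Proof.
elim: p d => //= f p IH d.
by rewrite -cats1 stop_cat IH /= nbrK.
Qed.

Lemma htpy_cat2 d p q u v :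
  path_htpy T (stop T d p) u v -> path_htpy T d (p ++ u ++ q) (p ++ v ++ q).
Proof.
elim=> {u v} [u v [a [r [r' [-> -> rr]]]]|u|u v _|u v w _ h1 _ h2].
- apply: rst_step; exists (p ++ a), r, (r' ++ q).
  by rewrite -!catA stop_cat.
- exact: rst_refl.
- exact: rst_sym.
- exact: rst_trans h1 h2.
Qed.

Lemma htpy_pinvr d p : path_htpy T d (p ++ pinv T d p) [::].
Proof.
elim: p d => [|f p IH] d /=; first exact: rst_refl.
apply: (@rst_trans _ _ _ [:: f; gperm T d f f]).
  have := @htpy_cat2 d [:: f] [:: gperm T d f f] _ _ (IH (nbr T d f)).
  by rewrite -cats1 -catA.
apply: rst_step; exists [::], [:: f; gperm T d f f], [::].
by split=> //; left; exists f.
Qed.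

Lemma pinv_cat d p q :
  pinv T d (p ++ q) = pinv T (stop T d p) q ++ pinv T d p.
Proof.
elim: p d => [|f p IH] d /=; first by rewrite cats0.
by rewrite IH rcons_cat.
Qed.

Lemma pinvK d p : pinv T (stop T d p) (pinv T d p) = p.
Proof.
elim: p d => //= f p IH d.
rewrite -cats1 pinv_cat IH stop_pinv /= gpermK.
by rewrite permK.
Qed.

Lemma htpy_pinvl d p : path_htpy T (stop T d p) (pinv T d p ++ p) [::].
Proof.
have := htpy_pinvr (stop T d p) (pinv T d p).
by rewrite pinvK.
Qed.

End PathLemmas.

(* The cover of M corresponding to alpha^-1(n Z), realized as usual by classes
   of paths issued from b; n = 0 gives the infinite cyclic cover. *)
Section Covers.
Variables (D : eqType) (T : triangulation D) (b : D) (alpha : epi_to_Z T b).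

Definition cover_rel (n : nat) (p q : seq 'I_4) : bool :=
  (stop T b p == stop T b q) && (n %| alpha (p ++ pinv T b q))%Z.

Lemma epi0 : alpha [::] = 0.
Proof.
have := @epi_cat _ _ _ alpha [::] [::] erefl erefl.
by rewrite /= => /(congr1 (fun z => z - alpha [::])); rewrite addrK subrr.
Qed.

Lemma stop_back p q : stop T b p = stop T b q ->
  stop T b (p ++ pinv T b q) = b.
Proof. by move=> e; rewrite stop_cat e stop_pinv. Qed.

Lemma epi_mid p q r : stop T b p = stop T b q -> stop T b q = stop T b r ->
  alpha (p ++ pinv T b r) = alpha (p ++ pinv T b q) + alpha (q ++ pinv T b r).
Proof.
move=> e1 e2; rewrite -epi_cat ?stop_back//; apply: epi_htpy.
  by rewrite stop_back// e1.
rewrite -catA (catA (pinv T b q)); apply: rst_sym.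
by apply: (@htpy_cat2 _ _ _ _ _ _ [::]); rewrite e1; apply: htpy_pinvl.
Qed.

Lemma epi_diag p : alpha (p ++ pinv T b p) = 0.
Proof.
rewrite -epi0; apply: epi_htpy; first exact: stop_back.
exact: htpy_pinvr.
Qed.

Lemma cover_rel_refl n : reflexive (cover_rel n).
Proof. by move=> p; rewrite /cover_rel eqxx epi_diag dvdz0. Qed.

Lemma cover_rel_sym n : symmetric (cover_rel n).
Proof.
move=> p q; rewrite /cover_rel eq_sym; case: eqP => //= e.
have := epi_mid (esym e) e; rewrite epi_diag => /esym/eqP.
by rewrite addr_eq0 => /eqP ->; rewrite rpredN.
Qed.

Lemma cover_rel_trans n : transitive (cover_rel n).
Proof.
move=> q p r /andP[/eqP e1 d1] /andP[/eqP e2 d2].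
by rewrite /cover_rel e1 e2 eqxx /= (epi_mid e1 e2) rpredD.
Qed.

Canonical cover_equiv n :=
  EquivRel (cover_rel n) (@cover_rel_refl n) (@cover_rel_sym n)
    (@cover_rel_trans n).

Definition cyclic_cover (n : nat) := {eq_quot (cover_equiv n)}%qT.

Definition cover_class n (p : seq 'I_4) : cyclic_cover n :=
  (\pi_(cyclic_cover n) p)%qT.

Definition cover_proj n (x : cyclic_cover n) : D := stop T b (qrepr x).

Definition cover_nbr n (x : cyclic_cover n) (f : 'I_4) : cyclic_cover n :=
  cover_class n (rcons (qrepr x) f).

Definition cover_gperm n (x : cyclic_cover n) (f : 'I_4) : 'S_4 :=
  gperm T (cover_proj x) f.

Lemma cover_classP n p q :
  reflect (cover_class n p = cover_class n q) (cover_rel n p q).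
Proof. exact: eqmodP. Qed.

Lemma repr_class n p : cover_rel n (qrepr (cover_class n p)) p.
Proof. by apply/cover_classP; rewrite /cover_class reprK. Qed.

Lemma cover_proj_class n p : cover_proj (cover_class n p) = stop T b p.
Proof. by case/andP: (repr_class n p) => /eqP. Qed.

Lemma cover_class_rcons n p q f : cover_rel n p q ->
  cover_class n (rcons p f) = cover_class n (rcons q f).
Proof.
case/andP=> /eqP e d; apply/cover_classP/andP; split.
  by rewrite -!cats1 !stop_cat e.
rewrite -!cats1 pinv_cat /=.
suff <- : alpha (p ++ pinv T b q) =
  alpha ((p ++ [:: f]) ++ [:: gperm T (stop T b q) f f] ++ pinv T b q) by [].
apply: epi_htpy; first exact: stop_back.
apply: rst_sym; apply: rst_step.
exists p, [:: f; gperm T (stop T b q) f f], (pinv T b q); split=> //.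
  by rewrite -catA.
by left; exists f; rewrite e.
Qed.

Lemma cover_nbrK n x f :
  cover_nbr (cover_nbr x f) (cover_gperm x f f) = x :> cyclic_cover n.
Proof.
rewrite /cover_nbr (cover_class_rcons _ (repr_class _ _)).
rewrite -[RHS]reprK; apply/cover_classP/andP.
set p := qrepr x; split.
  by rewrite -!cats1 !stop_cat /= nbrK.
suff -> : alpha (rcons (rcons p f) (cover_gperm x f f) ++ pinv T b p) = 0.
  exact: dvdz0.
rewrite -(epi_diag p); apply: epi_htpy.
  by rewrite stop_back// -!cats1 !stop_cat /= nbrK.
apply: rst_step; exists p, [:: f; cover_gperm x f f], (pinv T b p).
by split=> //; [rewrite -!cats1 -!catA | left; exists f].
Qed.

Lemma cover_proj_nbr n (x : cyclic_cover n) f :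
  cover_proj (cover_nbr x f) = nbr T (cover_proj x) f.
Proof. by rewrite cover_proj_class -cats1 stop_cat. Qed.

Lemma cover_gpermK n (x : cyclic_cover n) f :
  cover_gperm (cover_nbr x f) (cover_gperm x f f) = ((cover_gperm x f)^-1)%g.
Proof. by rewrite {1}/cover_gperm cover_proj_nbr gpermK. Qed.

Lemma cover_glue_free n (x : cyclic_cover n) f :
  (cover_nbr x f, cover_gperm x f f) <> (x, f).
Proof.
case=> /(congr1 (@cover_proj n)); rewrite cover_proj_nbr => e1 e2.
by apply: (@glue_free _ T (cover_proj x) f); congr pair.
Qed.

Lemma cover_gperm_odd n (x : cyclic_cover n) f : odd_perm (cover_gperm x f).
Proof. exact: gperm_odd. Qed.

Definition cover_triangulation n : triangulation (cyclic_cover n) :=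
  Triangulation (@cover_nbrK n) (@cover_gpermK n) (@cover_glue_free n)
    (@cover_gperm_odd n).

(* The projection of the infinite cyclic cover to the n-fold one. *)
Definition to_cyclic n (x : cyclic_cover 0) : cyclic_cover n :=
  cover_class n (qrepr x).

Definition loop_power (mu : seq 'I_4) (k : int) : seq 'I_4 :=
  match k with
  | Posz m => flatten (nseq m mu)
  | Negz m => flatten (nseq m.+1 (pinv T b mu))
  end.

(* The action of mu^k on the infinite cyclic cover. *)
Definition deck (mu : seq 'I_4) (k : int) (x : cyclic_cover 0) :
    cyclic_cover 0 :=
  cover_class 0 (loop_power mu k ++ qrepr x).

Definition deck_edge mu k (x : cyclic_cover 0 * {set 'I_4}) :=
  (deck mu k x.1, x.2).

End Covers.

Section Matrices.
Variables (N : nat) (T : triangulation 'I_N) (q : 'I_N -> 'I_3) (b : 'I_N).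
Variables (alpha : epi_to_Z T b) (mu : seq 'I_4).

Definition is_tet_lift (tD : 'I_N -> cyclic_cover alpha 0) : Prop :=
  forall j, cover_proj (tD j) = j.

Definition is_edge_lift (e : 'I_N -> 'I_N * {set 'I_4})
    (te : 'I_N -> cyclic_cover alpha 0 * {set 'I_4}) : Prop :=
  forall i, edge_eq T (cover_proj (te i).1, (te i).2) (e i).

Variables (te : 'I_N -> cyclic_cover alpha 0 * {set 'I_4})
          (tD : 'I_N -> cyclic_cover alpha 0).

(* The family of coefficients of t^k, for k in Z, of the twisted matrix. *)
Definition twisted_gluing (p : 'I_3) : int -> 'M[int]_N := fun k =>
  gluing_mx (cover_triangulation alpha 0) (q \o @cover_proj _ _ _ alpha 0)
    te (fun j => deck mu k (tD j)) p.

(* Indices of size \sum_(k < n) N are pairs (block, index in the block), in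
   lexicographic order. *)
Definition cyclic_gluing (n : nat) (p : 'I_3) : 'M[int]_(\sum_(k < n) N) :=
  gluing_mx (cover_triangulation alpha n) (q \o @cover_proj _ _ _ alpha n)
    (fun s => let x := deck_edge mu (tagnat.sig1 s)%:Z (te (tagnat.sig2 s)) in
              (to_cyclic n x.1, x.2))
    (fun s => to_cyclic n (deck mu (tagnat.sig1 s)%:Z (tD (tagnat.sig2 s)))) p.

End Matrices.

Definition laurent (N : nat) (X : int -> 'M[int]_N) : Prop :=
  finite_set [set r | X r != 0].

(* The sum over the infinite index set is meaningful when X is finitely
   supported. *)
Definition block_circulant (n N : nat) (X : int -> 'M[int]_N) :
    'M[int]_(\sum_(k < n) N, \sum_(l < n) N) :=
  \mxblock_(k < n, l < n)
    \sum_(r \in [set r : int | (r = l%:Z - k%:Z %[mod n%:Z])%Z]) X r.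

(* Main.v *)
Require Import Defs.
From HB Require Import structures.
From Stdlib Require Import Relation_Operators.
From mathcomp Require Import all_boot all_order all_algebra all_fingroup.
From mathcomp Require Import all_classical all_reals all_analysis.
From mathcomp Require Import zify.
Set Implicit Arguments.
Unset Strict Implicit.
Unset Printing Implicit Defensive.

Import Order.TTheory GRing.Theory Num.Theory.
Local Open Scope ring_scope.

(* Edge classes of the n-fold cover lift to edge classes of the infinite cyclic
   cover, so an edge of mu^l D_j is incident to the image of mu^k e_i downstairs
   iff, upstairs, the corresponding edge of mu^r D_j is incident to e_i for some
   r = l - k mod n.  The entries then agree because such an r is unique: an edge
   class upstairs meets the translates of a given edge of a tetrahedron at most
   once.  Indeed a walk around an edge of M that comes back to the same edge of
   the same tetrahedron comes back to the same flag (the orientation and the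
   absence of faces glued to themselves exclude the other possibilities), hence
   it is a power of a relator of pi_1, on which alpha vanishes.  This uniqueness
   also gives the finiteness of the support.  The curve mu matters only as a
   loop with alpha mu = 1. *)

(** * Permutations of four vertices that preserve an edge *)

Definition swap_ends : 'S_4 := tperm 0 1.
Definition swap_sides : 'S_4 := tperm two4 three4.

Lemma swap_endsC : (swap_ends * swap_sides = swap_sides * swap_ends)%g.
Proof.
by apply/permP; case=> [[|[|[|[|]]]]] // lt; rewrite !permM !permE /= ?permE.
Qed.

(** The pointwise stabilizer of two vertices has order two, so the sign decides. *)
Lemma perm_fix01 (s : 'S_4) : s 0 = 0 -> s 1 = 1 ->
  s = if odd_perm s then swap_sides else 1%g.
Proof.
move=> s0 s1.
have s2 : s two4 = two4 \/ s two4 = three4.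
  have : s two4 != 0 by rewrite -s0 (inj_eq perm_inj).
  have : s two4 != 1 by rewrite -s1 (inj_eq perm_inj).
  by case: (s two4) => [[|[|[|[|]]]]] // lt _ _; [left|right]; apply: val_inj.
have s3 : s three4 = two4 \/ s three4 = three4.
  have : s three4 != 0 by rewrite -s0 (inj_eq perm_inj).
  have : s three4 != 1 by rewrite -s1 (inj_eq perm_inj).
  by case: (s three4) => [[|[|[|[|]]]]] // lt _ _; [left|right]; apply: val_inj.
have s23 : s two4 <> s three4 by move/perm_inj.
have ext (r : 'S_4) : s 0 = r 0 -> s 1 = r 1 -> s two4 = r two4 ->
    s three4 = r three4 -> s = r.
  move=> e0 e1 e2 e3; apply/permP => -[[|[|[|[|]]]]] // lt.
  - by rewrite [Ordinal _](_ : _ = 0) //; apply: val_inj.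
  - by rewrite [Ordinal _](_ : _ = 1) //; apply: val_inj.
  - by rewrite [Ordinal _](_ : _ = two4) //; apply: val_inj.
  - by rewrite [Ordinal _](_ : _ = three4) //; apply: val_inj.
case: s2 s3 => [] e2 [] e3; rewrite ?e2 ?e3 in s23 *; try by case: s23.
  have -> : s = 1%g by apply: ext; rewrite !permE.
  by rewrite odd_perm1.
have -> : s = swap_sides by apply: ext; rewrite !permE.
by rewrite odd_tperm.
Qed.

(** The quotient of the two permutations is even and preserves [{0, 1}], so it is trivial or the
    product of the transpositions of ends and of sides. *)
Lemma same_edge_perm (r s : 'S_4) : odd_perm r = odd_perm s ->
  [set s 0; s 1]%SET = [set r 0; r 1]%SET ->
  s = r \/ s = (swap_ends * swap_sides * r)%g.
Proof.
move=> par e.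
have es1 : (swap_ends * s)%g 1 = s 0 by rewrite permM tpermR.
have es0 : (swap_ends * s)%g 0 = s 1 by rewrite permM tpermL.
have inv x y : s x = r y -> (s * r^-1)%g x = y.
  by move=> e1; rewrite permM e1 permK.
have : s 0 \in [set r 0; r 1]%SET by rewrite -e !inE eqxx.
have : s 1 \in [set r 0; r 1]%SET by rewrite -e !inE eqxx orbT.
have : s 0 != s 1 by rewrite (inj_eq perm_inj).
rewrite !inE => ne /orP[] /eqP e1 /orP[] /eqP e0; rewrite ?e0 ?e1 ?eqxx // in ne.
- right.
  have /perm_fix01 : (swap_ends * s * r^-1)%g 0 = 0.
    by rewrite permM es0 e1 permK.
  rewrite permM es1 e0 permK !odd_permM odd_tperm odd_permV par addbK.
  move=> /(_ erefl)/(congr1 (fun t => swap_ends * t * r)%g).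
  by rewrite mulgA mulgKV mulgA tperm2 mul1g.
- left.
  have /perm_fix01 : (s * r^-1)%g 0 = 0 by rewrite permM e0 permK.
  rewrite permM e1 permK odd_permM odd_permV par addbb => /(_ erefl).
  by move/(congr1 (fun t => t * r)%g); rewrite mulgKV mul1g.
Qed.

Lemma edge_flag (a : {set 'I_4}) : #|a| = 2%N ->
  exists r : 'S_4, [set r 0; r 1]%SET = a.
Proof.
move=> /eqP/cards2P[x [y [xy ->]]].
have [s s0] : exists s : 'S_4, s 0 = x by exists (tperm 0 x); rewrite tpermL.
have s1 : s 1 != x by rewrite -s0 (inj_eq perm_inj).
exists (s * tperm (s 1%R) y)%g; congr [set _; _]%SET; rewrite permM ?tpermL //.
by rewrite s0 tpermD // eq_sym.
Qed.

(** * Walks around an edge of a triangulation *)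

Section Turning.
Variables (D : Type) (T : triangulation D).
Implicit Type x : D * 'S_4.

(** Exchanging the two faces at the edge reverses the direction in which [turn] proceeds. *)
Definition flip_sides x : D * 'S_4 := (x.1, (swap_sides * x.2)%g).

(** The only other flag on the same edge with the same parity. *)
Definition reverse_edge x : D * 'S_4 := (x.1, (swap_ends * swap_sides * x.2)%g).

Definition flag_edge x : D * {set 'I_4} := (x.1, [set x.2 0; x.2 1]%SET).

Lemma flip_sidesK : involutive flip_sides.
Proof. by case=> d r; rewrite /flip_sides /= mulgA tperm2 mul1g. Qed.

(** Conjugation by the involution [flip_sides] inverts [turn]; this makes backward turns expressible
    by forward ones. *)
Lemma turn_flip_turn x : turn T (flip_sides (turn T x)) = flip_sides x.
Proof.
case: x => d r; rewrite /flip_sides /turn /= !permM !permE /= nbrK.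
by rewrite gpermK !mulgA tperm2 mul1g mulgK.
Qed.

Lemma turn_reverse_turn x : turn T (reverse_edge (turn T x)) = reverse_edge x.
Proof.
case: x => d r; rewrite /reverse_edge /turn /= !permM !permE /= nbrK.
rewrite gpermK !mulgA mulgK -/swap_sides -swap_endsC.
by rewrite -(mulgA swap_ends) tperm2 mulg1.
Qed.

Lemma turn_inj : injective (turn T).
Proof.
move=> x y e; apply: (can_inj flip_sidesK).
by rewrite -(turn_flip_turn x) -(turn_flip_turn y) e.
Qed.

Lemma flag_edge_flip x : flag_edge (flip_sides x) = flag_edge x.
Proof. by rewrite /flag_edge /= !permM !permE. Qed.

Lemma flag_edge_turn x :
  flag_edge (turn T x) =
  (nbr T x.1 (x.2 three4), gperm T x.1 (x.2 three4) @: (flag_edge x).2)%SET.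
Proof.
by rewrite /flag_edge /= !permM !permE /= imsetU1 imset_set1.
Qed.

(** Orientation enters here: each turn composes a transposition with an odd gluing. *)
Lemma odd_turn m x : odd_perm (iter m (turn T) x).2 = odd_perm x.2.
Proof.
by elim: m => //= m IH; rewrite !odd_permM odd_tperm gperm_odd addbT negbK.
Qed.

(* Turning backwards from the reversed flag shortens the path by two steps, so
   a reversal would happen either in no step or across a face glued to itself. *)
Lemma turn_not_reverse m x : iter m (turn T) x <> reverse_edge x.
Proof.
have [k] := ubnP m; elim: k m x => // k IH [|[|m]] x lt_m e.
- move: e => /(congr1 (fun y : D * 'S_4 => y.2 0)) /=.
  by rewrite !permM permE /= permE => /perm_inj.
- move: e => /(congr1 (fun y : D * 'S_4 => (y.1, y.2 two4))) /=.
  rewrite !permM !permE /= => -[e1 e2].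
  by apply: (@glue_free _ T x.1 (x.2 three4)); rewrite e1 e2.
- apply: (IH m (turn T x)); first by rewrite -ltnS ltnW.
  apply: turn_inj; rewrite turn_reverse_turn -iterS -iterSr //.
Qed.

(** By parity the final flag is [x] or its reversal, and the reversal is excluded. *)
Lemma turn_return m x : (flag_edge (iter m (turn T) x)) = flag_edge x ->
  iter m (turn T) x = x.
Proof.
move=> e; have := odd_turn m x; move: (@turn_not_reverse m x) e.
case: (iter _ _ _) => d r /= nrev [e1 e2] par.
case: (same_edge_perm (esym par) e2) => er.
  by rewrite er e1; case: x {nrev e1 e2 par er}.
by case: nrev; rewrite er e1.
Qed.

Lemma edge_step_sym (u v : D * {set 'I_4}) :
  edge_step T u v -> edge_step T v u.
Proof.
case: u v => d a [d' a'] [f /= fa [-> ->]]; exists (gperm T d f f) => /=.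
  by rewrite mem_imset //; exact: perm_inj.
rewrite nbrK gpermK; congr pair; rewrite -imset_comp.
by rewrite (eq_imset (g := id)) ?imset_id // => y /=; rewrite permK.
Qed.

(* If turning is periodic, two flags of equivalent edges can be joined by
   turning forwards only. *)
Lemma edge_eq_turn u v :
    (forall x, exists m, iter m.+1 (turn T) x = x) ->
    edge_eq T u v -> forall x, flag_edge x = u ->
  exists m, flag_edge (iter m (turn T) x) = v.
Proof.
move=> per.
pose P u v := forall x, flag_edge x = u -> exists m, flag_edge (iter m (turn T) x) = v.
have step a b : edge_step T a b -> P a b.
  move=> [f fa ->] x ea.
  have f23 : f = x.2 three4 \/ f = x.2 two4.
    move: fa; rewrite -ea -(permKV x.2 f) /= !inE !(inj_eq perm_inj).
    case: (x.2^-1%g f) => [[|[|[|[|]]]]] //= lt _; [right|left];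
    by congr (x.2 _); apply: val_inj.
  case: f23 => ef.
    by exists 1%N; rewrite [iter _ _ _]/= flag_edge_turn -ea ef.
  (* Crossing the other face is a backward turn: [y] is the predecessor of [x] under [turn], and
     periodicity reaches it by forward turns. *)
  pose y := flip_sides (turn T (flip_sides x)).
  have ey : turn T y = x by rewrite turn_flip_turn flip_sidesK.
  have [m em] := per y; exists m.
  rewrite -[in LHS]ey -iterSr em flag_edge_flip flag_edge_turn.
  rewrite flag_edge_flip -ea /= permM tpermR -ef //.
suff : edge_eq T u v -> P u v /\ P v u by move=> h /h[].
elim=> {u v} [a b ab|a|a b _ [] //|a b c _ [h1 h2] _ [h3 h4]].
- by split; apply: step => //; apply: edge_step_sym.
- by split=> x ea; exists 0%N.
- have tr a1 b1 c1 : P a1 b1 -> P b1 c1 -> P a1 c1.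
    move=> p1 p2 x /p1[m /p2[k ek]]; exists (k + m)%N.
    by rewrite iterD.
  by split; [exact: tr h1 h3|exact: tr h4 h2].
Qed.

Lemma turn_path_stop x m : (iter m (turn T) x).1 = stop T x.1 (turn_path T x m).
Proof.
elim: m => // m IH.
have iotaS : iota 0 m.+1 = iota 0 m ++ [:: m] by rewrite -(addn1 m) iotaD.
by rewrite /turn_path iotaS map_cat stop_cat -/(turn_path T x m) -IH.
Qed.

Lemma relator_stop d r : relator T d r -> stop T d r = d.
Proof.
case=> [[f ->] /=|[rho [m [e ->]]]]; first exact: nbrK.
by rewrite -(turn_path_stop (d, rho)) e.
Qed.

Lemma htpy_stop d p q : path_htpy T d p q -> stop T d p = stop T d q.
Proof.
elim=> // [u v [c [r [r' [-> -> /relator_stop e]]]]|u v w _ -> _ ->] //.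
by rewrite !stop_cat e.
Qed.

End Turning.

(** * Maps of triangulations that commute with the gluings *)

Section CoveringMap.
Variables (D D' : Type) (T : triangulation D) (T' : triangulation D').
Variable phi : D -> D'.
Hypothesis phi_nbr : forall x f, phi (nbr T x f) = nbr T' (phi x) f.
Hypothesis phi_gperm : forall x f, gperm T' (phi x) f = gperm T x f.

Lemma edge_eq_map x a y c :
  edge_eq T (x, a) (y, c) -> edge_eq T' (phi x, a) (phi y, c).
Proof.
suff H u v : edge_eq T u v -> edge_eq T' (phi u.1, u.2) (phi v.1, v.2).
  exact: (H (x, a) (y, c)).
elim=> {u v} [u v [f fu ->]|u|u v _|u v w _ h1 _ h2] /=.
- by apply: rst_step; exists f => //=; rewrite phi_nbr phi_gperm.
- exact: rst_refl.
- exact: rst_sym.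
- exact: rst_trans h1 h2.
Qed.

(** Path lifting with the right end prescribed. Quantifying over all lifts of that end in [P] lets
    successive steps be composed. *)
Lemma edge_eq_lift u y c : edge_eq T' u (phi y, c) ->
  exists2 x, phi x = u.1 & edge_eq T (x, u.2) (y, c).
Proof.
pose P u v := forall y, phi y = v.1 ->
  exists2 x, phi x = u.1 & edge_eq T (x, u.2) (y, v.2).
have step w v : edge_step T' w v -> P w v.
  move=> /edge_step_sym[f /= fv ->] z ez; exists (nbr T z f).
    by rewrite phi_nbr ez.
  apply: rst_sym; apply: rst_step; exists f => //=.
  by rewrite -ez phi_gperm.
suff H w v : edge_eq T' w v -> P w v /\ P v w by move=> /H[/(_ y erefl)].
elim=> {w v} [w v wv|w|w v _ []|w v z _ [h1 h2] _ [h3 h4]] //.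
- by split; apply: step => //; apply: edge_step_sym.
- by split=> z ez; exists z => //; apply: rst_refl.
- have tr a1 b1 c1 : P a1 b1 -> P b1 c1 -> P a1 c1.
    move=> p1 p2 z3 /p2[z2 /p1[z1 e1 h12] h23]; exists z1 => //.
    exact: rst_trans h12 h23.
  by split; [exact: tr h1 h3|exact: tr h4 h2].
Qed.

Lemma turn_map m x r :
  iter m (turn T') (phi x, r) =
  (phi (iter m (turn T) (x, r)).1, (iter m (turn T) (x, r)).2).
Proof.
by elim: m => // m IH; rewrite !iterS IH {1}/turn /= phi_nbr phi_gperm.
Qed.

Lemma turn_path_map m x r : turn_path T' (phi x, r) m = turn_path T (x, r) m.
Proof. by apply: eq_map => k; rewrite turn_map. Qed.

End CoveringMap.

(** * The cyclic covers and the deck action of [mu] *)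

Section CyclicCovers.
Variables (D : finType) (T : triangulation D) (b : D) (alpha : epi_to_Z T b).
Local Notation cls := (cover_class alpha).
Local Notation cov n := (cover_triangulation alpha n).

Lemma cover_class_surj n (x : cyclic_cover alpha n) : exists p, x = cls n p.
Proof.
by exists (generic_quotient.repr x); rewrite /cover_class generic_quotient.reprK.
Qed.

Lemma nbr_cover_class n p f : nbr (cov n) (cls n p) f = cls n (rcons p f).
Proof. by apply: cover_class_rcons; apply: Defs.repr_class. Qed.

Lemma stop_cover_class n p r : stop (cov n) (cls n p) r = cls n (p ++ r).
Proof.
elim: r p => [|f r IH] p; first by rewrite cats0.
by rewrite /= -[cover_nbr _ _]/(nbr (cov n) _ _) nbr_cover_class IH cat_rcons.
Qed.

Let cover_projN n (x : cyclic_cover alpha n) f :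
  cover_proj (nbr (cov n) x f) = nbr T (cover_proj x) f.
Proof. exact: cover_proj_nbr. Qed.

Let cover_projP n (x : cyclic_cover alpha n) f :
  gperm T (cover_proj x) f = gperm (cov n) x f.
Proof. by []. Qed.

(** A closed walk around an edge is a relator, so [alpha] vanishes on its conjugate by a path from
    [b] and the walk lifts to a closed one. *)
Lemma turn_cover_closed n m (x : cyclic_cover alpha n) r :
  iter m (turn T) (cover_proj x, r) = (cover_proj x, r) ->
  iter m (turn (cov n)) (x, r) = (x, r).
Proof.
move=> e; move: (e); rewrite (turn_map (@cover_projN n) (@cover_projP n)) => -[_ e2].
suff e1 : (iter m (turn (cov n)) (x, r)).1 = x.
  by move: e1 e2; case: (iter _ _ _) => /= y s -> ->.
rewrite turn_path_stop -(turn_path_map (@cover_projN n) (@cover_projP n)) /=.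
move: e; case: (cover_class_surj x) => p ->; rewrite cover_proj_class => e.
rewrite stop_cover_class; apply/cover_classP/andP.
have back : stop T b (p ++ turn_path T (stop T b p, r) m) = stop T b p.
  by rewrite stop_cat -(turn_path_stop T (stop T b p, r)) e.
split; first by rewrite back.
suff -> : alpha ((p ++ turn_path T (stop T b p, r) m) ++ Defs.pinv T b p) = 0.
  exact: dvdz0.
rewrite -(epi_diag alpha p); apply: epi_htpy; first exact: stop_back.
apply: rst_step; exists p, (turn_path T (stop T b p, r) m), (Defs.pinv T b p).
split=> //; first by rewrite catA.
by right; exists r, m.
Qed.

(** Forward turning joins the two edges. Its projection returns to the same edge of the same
    tetrahedron, hence to the same flag, and so the walk also closes in the cover. *)
Lemma edge_eq_fibre n (x y : cyclic_cover alpha n) (a : {set 'I_4}) :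
  #|a| = 2%N -> cover_proj x = cover_proj y ->
  edge_eq (cov n) (x, a) (y, a) -> x = y.
Proof.
move=> /edge_flag[r er] exy /edge_eq_turn H.
have /H{H} H : forall z, exists m, iter m.+1 (turn (cov n)) z = z.
  (* The period comes from the base: [turn] is injective on the finite set of flags of [T], and a
     closed walk there lifts to a closed walk. *)
  case=> z s; exists (fingraph.order (turn T) (cover_proj z, s)).-1.
  apply: turn_cover_closed; rewrite prednK ?fingraph.order_gt0 //.
  by apply: fingraph.iter_order; apply: turn_inj.
case: (H (x, r)) => [|m em]; first by rewrite /flag_edge er.
have /turn_cover_closed emx : iter m (turn T) (cover_proj x, r) = (cover_proj x, r).
  apply: turn_return; rewrite (turn_map (@cover_projN n) (@cover_projP n)).
  by move: em; rewrite /flag_edge /= => -[-> ->]; rewrite er exy.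
by move: em; rewrite emx => -[].
Qed.

Variable mu : seq 'I_4.
Hypothesis mu_loop : stop T b mu = b.
Hypothesis alpha_mu : alpha mu = 1.

Lemma epi_pinv p : stop T b p = b -> alpha (Defs.pinv T b p) = - alpha p.
Proof.
move=> ep; have := stop_pinv T b p; rewrite ep => ep'.
have := epi_diag alpha p; rewrite epi_cat // => /eqP.
by rewrite addrC addr_eq0 => /eqP.
Qed.

Lemma flatten_nseq_loop p m : stop T b p = b ->
  stop T b (flatten (nseq m p)) = b /\ alpha (flatten (nseq m p)) = alpha p *+ m.
Proof.
move=> ep; elim: m => [|m [IH1 IH2]] /=; first by rewrite epi0.
by rewrite stop_cat ep epi_cat // IH1 IH2 mulrS.
Qed.

Lemma pinv_mu_loop : stop T b (Defs.pinv T b mu) = b.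
Proof. by have := stop_pinv T b mu; rewrite mu_loop. Qed.

Lemma loop_power_stop k : stop T b (loop_power T b mu k) = b.
Proof.
case: k => m.
  by case: (flatten_nseq_loop m mu_loop).
by case: (flatten_nseq_loop m.+1 pinv_mu_loop).
Qed.

Lemma epi_loop_power k : alpha (loop_power T b mu k) = k.
Proof.
case: k => m.
  by case: (flatten_nseq_loop m mu_loop) => _ ->; rewrite alpha_mu natz.
case: (flatten_nseq_loop m.+1 pinv_mu_loop) => _ ->.
by rewrite epi_pinv // alpha_mu mulNrn NegzE natz.
Qed.

Lemma epi_loop_power_cat k l p q : stop T b p = stop T b q ->
  alpha ((loop_power T b mu k ++ p) ++ Defs.pinv T b (loop_power T b mu l ++ q)) =
  k - l + alpha (p ++ Defs.pinv T b q).
Proof.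
move=> e; have := loop_power_stop l; set s := loop_power _ _ _ l => es.
have es' : stop T b (Defs.pinv T b s) = b by have := stop_pinv T b s; rewrite es.
rewrite pinv_cat es -catA (catA p).
rewrite epi_cat ?loop_power_stop ?stop_cat //; last first.
  by rewrite e stop_pinv.
rewrite epi_cat //; last by rewrite stop_cat e stop_pinv.
by rewrite epi_pinv // !epi_loop_power (addrC (alpha _)) addrA.
Qed.

(** The identities between translates below reduce to this divisibility; for [n = 0] it says that
    the integer vanishes. *)
Lemma cover_rel_loop_power n k l p q :
  cover_rel alpha n (loop_power T b mu k ++ p) (loop_power T b mu l ++ q) =
  (stop T b p == stop T b q) && (n %| k - l + alpha (p ++ Defs.pinv T b q))%Z.
Proof.
rewrite /cover_rel !stop_cat !loop_power_stop.
by case: eqP => //= e; rewrite epi_loop_power_cat.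
Qed.

(** Frees [deck] from the representative chosen in its definition. *)
Lemma deck_class k p : deck mu k (cls 0 p) = cls 0 (loop_power T b mu k ++ p).
Proof.
apply/cover_classP; rewrite cover_rel_loop_power subrr add0r.
exact: Defs.repr_class.
Qed.

Lemma to_cyclic_class n p : to_cyclic n (cls 0 p) = cls n p.
Proof.
apply/cover_classP; have /andP[e d] := Defs.repr_class alpha 0 p.
by rewrite /cover_rel e; move: d; rewrite dvd0z => /eqP ->; rewrite dvdz0.
Qed.

Lemma cover_proj_deck k (x : cyclic_cover alpha 0) :
  cover_proj (deck mu k x) = cover_proj x.
Proof.
case: (cover_class_surj x) => p ->.
by rewrite deck_class !cover_proj_class stop_cat loop_power_stop.
Qed.

Lemma cover_proj_to_cyclic n (x : cyclic_cover alpha 0) :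
  cover_proj (to_cyclic n x) = cover_proj x.
Proof.
by case: (cover_class_surj x) => p ->; rewrite to_cyclic_class !cover_proj_class.
Qed.

Lemma deck_deck k l (x : cyclic_cover alpha 0) :
  deck mu k (deck mu l x) = deck mu (k + l) x.
Proof.
case: (cover_class_surj x) => p ->; rewrite !deck_class; apply/cover_classP.
rewrite cover_rel_loop_power stop_cat loop_power_stop eqxx /=.
(* [loop_power T b mu 0] is the empty path, which brings the right-hand path into the form required
   by the formula. *)
rewrite -[X in Defs.pinv T b X]/(loop_power T b mu 0 ++ p) epi_loop_power_cat //.
by rewrite epi_diag dvd0z; apply/eqP; rewrite opprD; lia.
Qed.

Lemma deck0 (x : cyclic_cover alpha 0) : deck mu 0 x = x.
Proof. by case: (cover_class_surj x) => p ->; rewrite deck_class. Qed.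

Lemma deck_free k l (x : cyclic_cover alpha 0) :
  deck mu k x = deck mu l x -> k = l.
Proof.
case: (cover_class_surj x) => p ->; rewrite !deck_class => /cover_classP.
rewrite cover_rel_loop_power epi_diag addr0 dvd0z subr_eq0.
by case/andP => _ /eqP.
Qed.

(** Together with [to_cyclic_eq], this identifies the fibres of [to_cyclic] with the orbits of the
    [n]-th power of [mu]. *)
Lemma to_cyclic_deck n m (x : cyclic_cover alpha 0) :
  to_cyclic n (deck mu (m * n%:Z) x) = to_cyclic n x.
Proof.
case: (cover_class_surj x) => p ->; rewrite !deck_class !to_cyclic_class.
apply/cover_classP; rewrite -[X in cover_rel _ _ _ X]/(loop_power T b mu 0 ++ p).
by rewrite cover_rel_loop_power eqxx epi_diag addr0 subr0 /= dvdz_mull.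
Qed.

Lemma to_cyclic_eq n (x y : cyclic_cover alpha 0) :
  to_cyclic n x = to_cyclic n y -> exists m, x = deck mu (m * n%:Z) y.
Proof.
case: (cover_class_surj x) (cover_class_surj y) => p -> [q ->].
rewrite !to_cyclic_class => /cover_classP/andP[e /dvdzP[m em]]; exists m.
rewrite deck_class; apply/cover_classP.
rewrite -[X in cover_rel _ _ X]/(loop_power T b mu 0 ++ p) cover_rel_loop_power.
by rewrite e em sub0r addNr dvdz0.
Qed.

(** The deck action prepends a loop to a path while crossing a face appends to it, so the two
    commute. *)
Lemma deck_nbr k (x : cyclic_cover alpha 0) f :
  deck mu k (nbr (cov 0) x f) = nbr (cov 0) (deck mu k x) f.
Proof.
case: (cover_class_surj x) => p ->.
by rewrite deck_class !nbr_cover_class deck_class rcons_cat.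
Qed.

Lemma deck_gperm k (x : cyclic_cover alpha 0) f :
  gperm (cov 0) (deck mu k x) f = gperm (cov 0) x f.
Proof. by rewrite /= /cover_gperm cover_proj_deck. Qed.

Lemma to_cyclic_nbr n (x : cyclic_cover alpha 0) f :
  to_cyclic n (nbr (cov 0) x f) = nbr (cov n) (to_cyclic n x) f.
Proof.
case: (cover_class_surj x) => p ->.
by rewrite to_cyclic_class !nbr_cover_class to_cyclic_class.
Qed.

Lemma to_cyclic_gperm n (x : cyclic_cover alpha 0) f :
  gperm (cov n) (to_cyclic n x) f = gperm (cov 0) x f.
Proof. by rewrite /= /cover_gperm cover_proj_to_cyclic. Qed.

Lemma edge_eq_deck k l (x y : cyclic_cover alpha 0) a c :
  edge_eq (cov 0) (deck mu l x, a) (deck mu k y, c) <->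
  edge_eq (cov 0) (deck mu (l - k) x, a) (y, c).
Proof.
split.
  move/(edge_eq_map (deck_nbr (- k)) (deck_gperm (- k))).
  by rewrite !deck_deck addNr deck0 addrC.
move/(edge_eq_map (deck_nbr k) (deck_gperm k)).
by rewrite deck_deck addrC subrK.
Qed.

(** Both translates lie over the same tetrahedron, so [edge_eq_fibre] identifies them, and the deck
    action is free. *)
Lemma edge_eq_deck_uniq k l (x : cyclic_cover alpha 0) (a : {set 'I_4}) v :
  #|a| = 2%N -> edge_eq (cov 0) (deck mu k x, a) v ->
  edge_eq (cov 0) (deck mu l x, a) v -> k = l.
Proof.
move=> a2 h1 h2; apply: (@deck_free k l x); apply: (edge_eq_fibre a2).
  by rewrite !cover_proj_deck.
by apply: rst_trans h1 _; apply: rst_sym.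
Qed.

Lemma edge_eq_cyclic n k l (x y : cyclic_cover alpha 0) a c :
  edge_eq (cov n) (to_cyclic n (deck mu l x), a) (to_cyclic n (deck mu k y), c)
  <-> exists2 r : int, (r = l - k %[mod n])%Z &
        edge_eq (cov 0) (deck mu r x, a) (y, c).
Proof.
split=> [/(edge_eq_lift (@to_cyclic_nbr n) (@to_cyclic_gperm n))[z /= ez]|].
  (* The lifted start lies over the image of [deck mu l x], so it differs from it by a multiple
     [m * n] of the deck generator; this gives the exponent [m * n + l - k]. *)
  case: (to_cyclic_eq ez) => m ->; rewrite deck_deck edge_eq_deck.
  by exists (m * n%:Z + l - k) => //; rewrite -addrA modzMDl.
case=> r /eqP; rewrite eqz_mod_dvd => /dvdzP[m em] h.
rewrite -(to_cyclic_deck n m (deck mu l x)) deck_deck.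
apply: (edge_eq_map (@to_cyclic_nbr n) (@to_cyclic_gperm n)).
by rewrite edge_eq_deck -addrA -em subrK.
Qed.

End CyclicCovers.

(** * Closedness of peripheral loops, and finite counting *)

Lemma peripheral_loop (R : realType) (D : Type) (T : triangulation D) b mu :
  peripheral R T b mu -> stop T b mu = b.
Proof.
case=> [c [p [v [[_ _ closed _] _ hp]]]].
rewrite (htpy_stop hp).
(* A walk in the link projects to a walk through tetrahedra, so a closed link curve gives a closed
   path. *)
have lstop1 x r : (lstop T x r).1 = stop T x.1 r.
  by elim: r x => //= f r IH x; rewrite IH.
by rewrite !stop_cat -(lstop1 (stop T b c, v)) closed stop_pinv.
Qed.

Lemma card_quad_pair k (a : {set 'I_4}) : a \in quad_pair k -> #|a| = 2%N.
Proof.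
have e2 : #|[set ord0; lift ord0 k]%SET| = 2%N by rewrite cards2 neq_lift.
rewrite !inE => /orP[]/eqP -> //.
by have := cardsC [set ord0; lift ord0 k]%SET; rewrite e2 card_ord => -[].
Qed.

(** Double counting: each counted [a] has exactly one index [r] with [P' r a], and that index is in
    [s] and satisfies [B]. *)
Lemma card_fibre_sum (I : eqType) (A : finType) (s : seq I) (B : pred I)
    (Q : {set A}) (P : pred A) (P' : I -> pred A) : uniq s ->
    (forall a, a \in Q -> P a -> exists r, [/\ r \in s, B r & P' r a]) ->
    (forall a r, B r -> P' r a -> P a) ->
    (forall a r r', a \in Q -> P' r a -> P' r' a -> r = r') ->
  #|[set a in Q | P a]%SET| =
  (\sum_(r <- s | B r) #|[set a in Q | P' r a]%SET|)%N.
Proof.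
move=> us Pex exP P'inj.
have card_sum (p : pred A) : #|[set a in Q | p a]%SET| = (\sum_(a in Q) p a)%N.
  rewrite -sum1dep_card big_mkcondr; apply: eq_bigr => a _.
  by case: (p a).
rewrite card_sum; under [RHS]eq_bigr do rewrite card_sum.
rewrite exchange_big; apply: eq_bigr => a aQ /=.
have [Pa|nPa] := boolP (P a); last first.
  by rewrite big1 // => r Br; case: (boolP (P' r a)) nPa => // /(exP _ _ Br) ->.
have [r0 [r0s Br0 P'r0]] := Pex a aQ Pa.
rewrite big_mkcond (bigD1_seq r0) //= Br0 P'r0 big1 // => r nr.
case: ifP => // _; case: (boolP (P' r a)) => // P'r.
by rewrite (P'inj _ _ _ aQ P'r P'r0) eqxx in nr.
Qed.

Lemma finite_set_uniq (I : eqType) (A : set I) : finite_set A ->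
  exists2 s : seq I, uniq s & forall r, r \in s <-> A r.
Proof.
case/finite_seqP => s ->; exists (undup s); first exact: undup_uniq.
by move=> r; rewrite mem_undup.
Qed.

(** * Block circulant matrices of finitely supported families *)

Section BlockCirculant.
Variable N : nat.
Implicit Types X Y : int -> 'M[int]_N.

Lemma laurentB X Y : laurent X -> laurent Y -> laurent (X - Y).
Proof.
move=> fX fY.
apply: (@sub_finite_set _ _ ([set r | X r != 0] `|` [set r | Y r != 0])%classic);
  last by rewrite finite_setU.
move=> r /=.
have [X0|] := eqVneq (X r) 0; last by left.
by move=> h; right; apply: contraNneq h => Y0; rewrite !fctE X0 Y0 subrr.
Qed.

(** Any duplicate-free list containing the support computes the sums, which turns them into ordinary
    finite sums. *)
Lemma block_circulantE n X (s : seq int) : uniq s ->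
    (forall r, r \notin s -> X r = 0) ->
  block_circulant n X = \mxblock_(k < n, l < n)
    \sum_(r <- s | (r == l%:Z - k%:Z %[mod n%:Z])%Z) X r.
Proof.
move=> us sX; apply: eq_mxblock => k l; apply/esym.
rewrite bigfs // => [|r _]; last exact: sX.
by congr (\sum_(r \in _) X r); apply/seteqP; split=> r /= /eqP.
Qed.

Lemma block_circulantB n X Y : laurent X -> laurent Y ->
  block_circulant n (X - Y) = block_circulant n X - block_circulant n Y.
Proof.
move=> fX fY.
(* One list covering both supports serves for [X], [Y] and [X - Y] at once. *)
have : finite_set ([set r | X r != 0] `|` [set r | Y r != 0])%classic.
  by rewrite finite_setU.
case/finite_set_uniq => s us sE.
have sXY r : r \notin s -> X r = 0 /\ Y r = 0.
  by move/negP; rewrite sE => /not_orP[/negP/negPn/eqP -> /negP/negPn/eqP ->].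
have sX r : r \notin s -> X r = 0 by case/sXY.
have sY r : r \notin s -> Y r = 0 by case/sXY.
have sB r : r \notin s -> (X - Y) r = 0.
  by move=> h; rewrite !fctE sX // sY // subrr.
rewrite (block_circulantE _ us sB) (block_circulantE _ us sX).
rewrite (block_circulantE _ us sY) -mxblockB; apply: eq_mxblock => k l.
by rewrite -sumrB.
Qed.

End BlockCirculant.

(** * Comparison of twisted and cyclic gluing matrices *)

Section GluingMatrices.
Variables (N : nat) (T : triangulation 'I_N) (q : 'I_N -> 'I_3) (b : 'I_N).
Variables (alpha : epi_to_Z T b) (mu : seq 'I_4).
Hypothesis mu_loop : stop T b mu = b.
Hypothesis alpha_mu : alpha mu = 1.
Variables (te : 'I_N -> cyclic_cover alpha 0 * {set 'I_4})
          (tD : 'I_N -> cyclic_cover alpha 0).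

Let incident r i j a : Prop :=
  edge_eq (cover_triangulation alpha 0) (deck mu r (tD j), a) (te i).

Let quad p j := quad_pair (q (cover_proj (tD j)) + p).

Lemma twisted_gluingE p r i j :
  twisted_gluing q mu te tD p r i j =
  #|[set a in quad p j | `[< incident r i j a >]]%SET|%:Z.
Proof. by rewrite !mxE /incidence /= cover_proj_deck. Qed.

Lemma incident_uniq i j (a : {set 'I_4}) r s : #|a| = 2%N ->
  incident r i j a -> incident s i j a -> r = s.
Proof. exact: edge_eq_deck_uniq. Qed.

(** Entries are cardinalities, so one incidence already puts [r] in the support. *)
Lemma twisted_gluing_neq0 p r i j a : a \in quad p j -> incident r i j a ->
  twisted_gluing q mu te tD p r != 0.
Proof.
move=> aQ inc; apply/eqP => /matrixP/(_ i j); rewrite twisted_gluingE mxE.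
case=> /eqP; rewrite cards_eq0 => /eqP/setP/(_ a).
by rewrite finset.in_set aQ finset.in_set0 /=; move/asboolP: inc => ->.
Qed.

Lemma laurent_twisted_gluing p : laurent (twisted_gluing q mu te tD p).
Proof.
(* Each triple of an edge, a tetrahedron and a vertex set admits at most one exponent when the set
   is an edge of the quad. The default [0] only enlarges the finite image that bounds the
   support. *)
pose level (x : 'I_N * 'I_N * {set 'I_4}) : int :=
  xget 0 [set r | incident r x.1.1 x.1.2 x.2]%classic.
apply: (sub_finite_set (B := (level @` [set: _])%classic)); last first.
  by apply: finite_image; apply: finite_finset.
move=> r /=; apply: contraNP => nlevel; apply/eqP/matrixP => i j.
rewrite twisted_gluingE mxE; congr Posz; apply/eqP; rewrite cards_eq0.
apply/eqP/setP => a; rewrite finset.in_set finset.in_set0; apply/negP => /andP[aQ /asboolP inc].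
apply: nlevel; exists (i, j, a) => //.
apply: (incident_uniq (card_quad_pair aQ) _ inc).
by apply: (@xgetPex _ 0 [set s | incident s i j a]%classic); exists r.
Qed.

Lemma cyclic_gluing_block_circulant n p :
  cyclic_gluing q mu te tD n p =
  block_circulant n (twisted_gluing q mu te tD p).
Proof.
have [S uS SE] := finite_set_uniq (laurent_twisted_gluing p).
rewrite (block_circulantE n uS); last first.
  by move=> r /negP; rewrite SE => /negP/negPn/eqP.
apply/matrixP => s t; rewrite [RHS]mxE [LHS]mxE summxE.
set k := tagnat.sig1 s; set i := tagnat.sig2 s.
set l := tagnat.sig1 t; set j := tagnat.sig2 t.
under eq_bigr do rewrite twisted_gluingE.
rewrite /incidence /= cover_proj_to_cyclic cover_proj_deck //.
rewrite -(big_morph Posz PoszD (erefl (Posz 0))); congr Posz.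
(* For each edge [a] of the quad pair, [cyc] yields the exponents in the right residue class and
   [incident_uniq] shows that there is at most one, as [card_fibre_sum] requires. *)
have cyc := @edge_eq_cyclic _ T b alpha mu mu_loop alpha_mu n k%:Z l%:Z
  (tD j) (te i).1.
apply: card_fibre_sum.
- exact: uS.
- move=> a aQ /asboolP/cyc[r er]; rewrite -surjective_pairing => inc.
  exists r; split; [|exact/eqP|exact/asboolP].
  by apply/SE; apply: twisted_gluing_neq0 aQ inc.
- move=> a r /eqP er /asboolP inc; apply/asboolP/cyc; exists r => //.
  by rewrite -surjective_pairing.
- by move=> a r r' /card_quad_pair a2 /asboolP h1 /asboolP; apply: incident_uniq.
Qed.

End GluingMatrices.

Theorem theorem1p1 (R : realType) (N : nat) (T : triangulation 'I_N)
    (hyp : hyperbolic R T) (cusp : one_cusped T)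
    (q : 'I_N -> 'I_3)
    (e : 'I_N -> 'I_N * {set 'I_4}) (he : edge_enumeration T e)
    (b : 'I_N) (alpha : epi_to_Z T b)
    (mu : seq 'I_4) (hmu : peripheral R T b mu) (alpha_mu : alpha mu = 1)
    (te : 'I_N -> cyclic_cover alpha 0 * {set 'I_4}) (hte : is_edge_lift e te)
    (tD : 'I_N -> cyclic_cover alpha 0) (htD : is_tet_lift tD)
    (n : nat) (n_gt0 : (0 < n)%N) :
  let Gt := twisted_gluing q mu te tD in
  let Gn := cyclic_gluing q mu te tD n in
  [/\ forall p : 'I_3,
        laurent (Gt p) /\ Gn p = block_circulant n (Gt p),
      laurent (NZA Gt) /\ NZA Gn = block_circulant n (NZA Gt)
    & laurent (NZB Gt) /\ NZB Gn = block_circulant n (NZB Gt)].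
Proof.
move=> Gt Gn; have mu_loop := peripheral_loop hmu.
have fin p : laurent (Gt p) by apply: laurent_twisted_gluing.
have circ p : Gn p = block_circulant n (Gt p).
  exact: cyclic_gluing_block_circulant.
split=> [p||]; first by [].
(* The Neumann-Zagier matrices are differences of gluing matrices, and the block circulant form is
   additive on finitely supported families. *)
- by rewrite /NZA block_circulantB // !circ; split=> //; apply: laurentB.
- by rewrite /NZB block_circulantB // !circ; split=> //; apply: laurentB.
Qed.
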